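(* Let $k$ be a positive integer. For every finitely supported $u:\mathbb{Z}\to\mathbb{R}$ with $u(0)=0$, $$\sum_{n \in \mathbb{Z}}|u(n)-u(n-1)|^2 \Big(n-\frac{1}{2}\Big)^{2k} \geq \frac{(2k-1)^2}{4} \sum_{n \in \mathbb{Z}} |u(n)|^2 n^{2k-2}.$$ Moreover, the constant $(2k-1)^2/4$ is sharp.
   Context: ''Sharp'' means that the inequality fails for a strictly bigger constant: for every real $C>(2k-1)^2/4$ there is a finitely supported $u:\mathbb{Z}\to\mathbb{R}$ with $u(0)=0$ for which the inequality with $C$ in place of $(2k-1)^2/4$ is false. The convention $n^0=1$ is used for all $n$. *)

(* Defs.v *)
From HB Require Import structures.
From mathcomp Require Import all_boot all_order all_algebra.
From mathcomp Require Import all_classical all_reals.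

Set Implicit Arguments.
Unset Strict Implicit.
Unset Printing Implicit Defensive.

Import Order.TTheory GRing.Theory Num.Theory.

Local Open Scope classical_set_scope.
Local Open Scope ring_scope.

Definition finitely_supported (R : realType) (u : int -> R) : Prop :=
  finite_set [set n | u n != 0].

(* The inequality with a constant [C], for a given [u].  The sums are over all
   of [int]; the library's [\sum_(n \in A)] is 0 on a summand of infinite
   support, which cannot happen when [u] is finitely supported.  As [x ^+ 0] is
   1 for every [x], the weight on the right is identically 1 when [k = 1]; the
   natural subtraction [2 * k - 2] is exact for [k >= 1]. *)
Definition hardy_ineq (R : realType) (k : nat) (C : R) (u : int -> R) : Prop :=
  \sum_(n \in [set: int])
      (`|u n - u (n - 1)| ^+ 2 * (n%:~R - 1 / 2) ^+ (2 * k))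
  >= C * \sum_(n \in [set: int]) (`|u n| ^+ 2 * n%:~R ^+ (2 * k - 2)).

(* Main.v *)
Require Import Defs.
From mathcomp Require Import all_boot all_order all_algebra.
From mathcomp Require Import all_classical all_reals.
From mathcomp Require Import topology normedtype sequences.
From mathcomp Require Import zify ring lra.

(** Write x = n - 1/2 and q n = n^2 + 1/4.

    The inequality.  A weighted arithmetic-geometric mean inequality on each
    edge replaces the cross term of x^(2k) (u n - u (n-1))^2 by diagonal terms:
    since x^4 <= q n * q (n-1), every t > 0 satisfies
      2 x^(2k) u n u (n-1) <= t (q n)^k (u n)^2 + t^-1 (q (n-1))^k (u (n-1))^2
    ([energy_density_ge]).  The weight t = (4n-3)/(4n-1) is positive at every
    integer n, on both sides of the origin, so that the two half-lines need no
    separate treatment.  It is the ratio h (n-1) / h n for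
    h n = Gamma (n + 3/4) / Gamma (n + 1/4), which behaves like the square root
    of n: this is the weight that proves the unweighted Hardy inequality.
    Collecting the diagonal terms at the vertex n <> 0 leaves the coefficient
      (q n - n)^k + (q n + n)^k - 2 (q n)^k + 4 (q n)^k / (16 n^2 - 1),
    because (n -+ 1/2)^2 = q n -+ n.  The second difference of the power
    function is at least k (k-1) n^(2k-2) ([sum_pow_ge]) and the last summand is
    at least n^(2k-2) / 4, and k (k-1) + 1/4 = (2k-1)^2 / 4
    ([vertex_weight_ge]).  At n = 0 both sides vanish with u.

    Sharpness.  The function n^(-(k - 1/2)) on the positive integers is
    asymptotically extremal: its energy density is at most
    ((2k-1)^2 / 4 + o(1)) / n ([profile_energy]), and its norm density is
    exactly 1/n.  Subtracting its value at N and cutting at N makes it finitely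
    supported; this leaves the increments unchanged, up to the first one, and
    lowers the norm by an amount that a Young inequality controls
    ([truncated_profile_norm]).  Since the harmonic series diverges, the bounded
    errors are negligible, and any constant C > (2k-1)^2 / 4 is defeated for
    large N. *)

Set Implicit Arguments.
Unset Strict Implicit.
Unset Printing Implicit Defensive.

Import Order.TTheory GRing.Theory Num.Theory.

Local Open Scope ring_scope.

(** * Finitely supported sums over the integers *)

(** Turns the sums of the theorem into sums over an interval of naturals, where
    telescoping and splitting are available. *)
Lemma fsum_window (V : nmodType) (f : int -> V) (a : int) (n : nat) :
  (forall z, f z != 0 -> exists2 i, (i < n)%N & z = a + i%:Z) ->
  \sum_(z \in [set: int]) f z = \sum_(0 <= i < n) f (a + i%:Z).
Proof.
move=> supp; rewrite (@fsbigE _ _ _ _ _ [seq a + i%:Z | i <- iota 0 n]) //.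
- rewrite big_map /index_iota subn0; apply: eq_bigl => i.
  by rewrite in_setT.
- by rewrite map_inj_uniq ?iota_uniq // => i j /addrI [].
- move=> z _; apply: contraNeq => /supp[i ltin ->].
  by apply/mapP; exists i; rewrite // mem_iota.
Qed.

Lemma finite_set_int_bounded (A : set int) : finite_set A ->
  exists N : nat, forall z, A z -> (absz z < N)%N.
Proof.
move=> /finite_seqP[s ->]; exists (\max_(z <- s) absz z).+1 => z /= zs.
by rewrite ltnS; apply: leq_bigmax_seq.
Qed.

(** * The inequality *)

Lemma weighted_AMGM (R : realFieldType) (t P Q X a b : R) :
  0 < t -> 0 <= P -> 0 <= Q -> X ^+ 2 <= P * Q ->
  2 * X * (a * b) <= t * P * a ^+ 2 + t^-1 * Q * b ^+ 2.
Proof.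
move=> t0 P0 Q0 XPQ.
set A := t * P * a ^+ 2; set B := t^-1 * Q * b ^+ 2.
have A0 : 0 <= A by rewrite mulr_ge0 ?sqr_ge0 // mulr_ge0 // ltW.
have B0 : 0 <= B by rewrite mulr_ge0 ?sqr_ge0 // mulr_ge0 // invr_ge0 ltW.
have AB : A * B = P * Q * (a * b) ^+ 2 by rewrite /A /B; field; rewrite gt_eqF.
have XAB : (X * (a * b)) ^+ 2 <= A * B.
  by rewrite AB exprMn ler_wpM2r ?sqr_ge0.
rewrite leNgt; apply/negP => lt; have := sqr_ge0 (A - B).
have : (A + B) ^+ 2 < (2 * X * (a * b)) ^+ 2.
  by rewrite ltrXn2r ?gt_eqF ?addr_ge0.
by nra.
Qed.

(** The cross term is absorbed thanks to
    (n - 1/2)^4 + 1/4 = (n^2 + 1/4) ((n-1)^2 + 1/4). *)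
Lemma energy_density_ge (R : realFieldType) (k : nat) (n t a b : R) : 0 < t ->
  ((n - 1 / 2) ^+ (2 * k) - t * (n ^+ 2 + 1 / 4) ^+ k) * a ^+ 2 +
  ((n - 1 / 2) ^+ (2 * k) - t^-1 * ((n - 1) ^+ 2 + 1 / 4) ^+ k) * b ^+ 2
  <= (a - b) ^+ 2 * (n - 1 / 2) ^+ (2 * k).
Proof.
move=> t0; rewrite exprM.
set X := (_ ^+ 2) ^+ k; set P := (n ^+ 2 + _) ^+ k; set Q := (_ + _) ^+ k.
have sq_pos (y : R) : 0 <= y ^+ 2 + 1 / 4.
  by have := sqr_ge0 y; lra.
have := @weighted_AMGM _ t P Q X a b t0.
have -> : 0 <= P by rewrite exprn_ge0.
have -> : 0 <= Q by rewrite exprn_ge0.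
have -> : X ^+ 2 <= P * Q.
  rewrite /X /P /Q -exprMn exprAC lerXn2r ?nnegrE ?sqr_ge0 //.
    by rewrite mulr_ge0 // sq_pos.
  by nra.
by move=> /(_ isT isT isT); lra.
Qed.

(** By the binomial formula the even part of (q + n)^(k+1) is
    q^(k+1) + k (k+1) / 2 * q^(k-1) n^2 + ..., with nonnegative summands, and
    q^(k-1) >= n^(2k-2). *)
Lemma sum_pow_ge (R : realFieldType) (q n : R) (k : nat) : n ^+ 2 <= q ->
  2 * q ^+ k.+1 + (k * k.+1)%:R * (n ^+ 2) ^+ k
    <= (q + n) ^+ k.+1 + (q - n) ^+ k.+1.
Proof.
move=> nq; have n0 := sqr_ge0 n; have q0 := le_trans n0 nq.
(* The recursion of the even part in the exponent involves the odd part, which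
   is bounded along with it; the factor n makes the sign of n irrelevant. *)
suff [] : 2 * q ^+ k.+1 + (k * k.+1)%:R * (n ^+ 2) ^+ k
    <= (q + n) ^+ k.+1 + (q - n) ^+ k.+1 /\
    2 * k.+1%:R * (n ^+ 2) ^+ k.+1
    <= n * ((q + n) ^+ k.+1 - (q - n) ^+ k.+1) by [].
elim: k => [|k [IHf IHg]]; first by split; rewrite ?mul0n !expr1; nra.
rewrite ![_ ^+ k.+2]exprS.
set f1 := (q + n) ^+ k.+1 in IHf IHg *; set f2 := (q - n) ^+ k.+1 in IHf IHg *.
have s0 : 0 <= (n ^+ 2) ^+ k by rewrite exprn_ge0.
have qk : (n ^+ 2) ^+ k.+1 <= q ^+ k.+1 by rewrite lerXn2r.
have sS : (n ^+ 2) ^+ k.+1 = n ^+ 2 * (n ^+ 2) ^+ k by rewrite exprS.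
have kk : 0 <= (k * k.+1)%:R :> R by [].
split.
  have -> : (k.+1 * k.+2)%:R = (k * k.+1)%:R + 2 * k.+1%:R :> R.
    by rewrite -!natrM -natrD; congr (_%:R); lia.
  have h1 := ler_wpM2l q0 IHf.
  have h2 : (k * k.+1)%:R * (n ^+ 2) ^+ k.+1
      <= (k * k.+1)%:R * (q * (n ^+ 2) ^+ k).
    by rewrite ler_wpM2l // sS ler_wpM2r.
  by lra.
have h1 := ler_wpM2l q0 IHg.
have h2 := ler_wpM2l n0 IHf.
have h3 : k.+1%:R * (n ^+ 2 * (n ^+ 2) ^+ k.+1)
   <= k.+1%:R * (q * (n ^+ 2) ^+ k.+1) :> R.
  by rewrite ler_wpM2l // ler_wpM2r // exprn_ge0.
have h4 := ler_wpM2l n0 qk.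
have h5 : 0 <= n ^+ 2 * ((k * k.+1)%:R * (n ^+ 2) ^+ k).
  by rewrite mulr_ge0 // mulr_ge0.
rewrite -[k.+2%:R]natr1; lra.
Qed.

Definition edge_ratio (R : realFieldType) (n : R) : R := (4 * n - 3) / (4 * n - 1).

(** The pole 1/4 and the zero 3/4 lie strictly between the integers 0 and 1,
    hence the positivity on both half-lines. *)
Lemma edge_ratio_gt0 (R : realFieldType) (z : int) : 0 < edge_ratio (z%:~R : R).
Proof.
have [z1|z0] : (1 <= z) \/ (z <= 0) by lia.
  have : 1 <= z%:~R :> R by rewrite -[1]/(1%:~R) ler_int.
  by move=> ?; rewrite divr_gt0 //; lra.
have : z%:~R <= 0 :> R by rewrite -[0]/(0%:~R) ler_int.
by move=> ?; rewrite /edge_ratio -mulrNN -invrN divr_gt0 //; lra.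
Qed.

(** The coefficient that the edges n and n + 1 leave at the vertex n.  The
    binomial bound yields k (k+1), and the deficit 4 / (16 n^2 - 1) of the edge
    weights from 2 yields the missing 1/4. *)
Lemma vertex_weight_ge (R : realFieldType) (k : nat) (n : R) : 1 <= n ^+ 2 ->
  (2 * k.+1%:R - 1) ^+ 2 / 4 * n ^+ (2 * k) <=
  (n - 1 / 2) ^+ (2 * k.+1) + (n + 1 / 2) ^+ (2 * k.+1)
  - (n ^+ 2 + 1 / 4) ^+ k.+1 * (edge_ratio n + (edge_ratio (n + 1))^-1).
Proof.
move=> n1; set q := n ^+ 2 + 1 / 4.
have nq : n ^+ 2 <= q by rewrite /q; lra.
have d0 : 0 < 16 * n ^+ 2 - 1 by lra.
have -> : edge_ratio n + (edge_ratio (n + 1))^-1 = 2 - 4 / (16 * n ^+ 2 - 1).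
  rewrite /edge_ratio; field.
  by apply/and4P; split; apply/eqP => ?; nra.
have gain : n ^+ (2 * k) / 4 <= q ^+ k.+1 * (4 / (16 * n ^+ 2 - 1)).
  rewrite mulrA ler_pdivlMr // exprM.
  have h : (n ^+ 2) ^+ k.+1 <= q ^+ k.+1 by rewrite lerXn2r // nnegrE; lra.
  have : 0 <= (n ^+ 2) ^+ k by rewrite exprn_ge0 // sqr_ge0.
  by rewrite exprS in h; nra.
have := @sum_pow_ge R q n k nq.
rewrite !(exprM _ 2 k.+1).
have -> : (n - 1 / 2) ^+ 2 = q - n by rewrite /q; field.
have -> : (n + 1 / 2) ^+ 2 = q + n by rewrite /q; field.
rewrite -exprM natrM -natr1.
by lra.
Qed.

Lemma hardy (R : realType) (k : nat) (u : int -> R) :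
  finitely_supported u -> u 0 = 0 ->
  hardy_ineq k.+1 ((2 * k.+1%:R - 1) ^+ 2 / 4) u.
Proof.
move=> /finite_set_int_bounded[N uN] u0; rewrite /hardy_ineq.
have uz z : (N <= absz z)%N -> u z = 0.
  by move=> Nz; apply: contraTeq Nz => /eqP/eqP/uN; rewrite -ltnNge.
have supp (z : int) : (absz z < N)%N || (absz (z - 1) < N)%N ->
    exists2 i, (i < (2 * N).+1)%N & z = - N%:Z + i%:Z.
  by move=> h; exists (absz (z + N%:Z)); lia.
have -> : (2 * k.+1 - 2 = 2 * k)%N by lia.
rewrite (@fsum_window _ _ (- N%:Z) (2 * N).+1); last first.
  move=> z; apply: contraNP => nz; apply/eqP.
  rewrite uz ?normr0 ?expr0n ?mul0r // leqNgt; apply/negP => h.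
  by apply/nz/supp; rewrite h.
rewrite (@fsum_window _ _ (- N%:Z) (2 * N).+1); last first.
  move=> z; apply: contraNP => nz; apply/eqP.
  rewrite !uz ?subrr ?normr0 ?expr0n ?mul0r // leqNgt; apply/negP => h;
    by apply/nz/supp; rewrite h ?orbT.
(* The part of the diagonal terms that the edge z + 1 puts on the vertex z is
   moved to the edge z by adding a telescoping sum, so that the inequality can
   be checked edge by edge. *)
pose H (z : int) : R := ((z%:~R + 1 / 2) ^+ (2 * k.+1)
  - (edge_ratio (z%:~R + 1))^-1 * (z%:~R ^+ 2 + 1 / 4) ^+ k.+1) * u z ^+ 2.
pose G (i : nat) := H (- N%:Z + i%:Z - 1).
have tele : \sum_(0 <= i < (2 * N).+1) (G i.+1 - G i) = 0.
  rewrite telescope_sumr // /G /H !uz ?expr0n ?mulr0 ?subrr //; lia.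
rewrite mulr_sumr -subr_ge0 -sumrB -[X in _ <= X]addr0 -[X in _ + X]tele.
rewrite -big_split /=.
apply: sumr_ge0 => i _; rewrite /G.
have -> : - N%:Z + i.+1%:Z - 1 = - N%:Z + i%:Z by lia.
set z := - N%:Z + i%:Z; rewrite /H intrB -[1%:~R]/(1 : R).
rewrite !real_normK ?num_real //.
have -> : (z%:~R - 1 + 1 / 2 = z%:~R - 1 / 2 :> R) by lra.
rewrite subrK.
have := @energy_density_ge R k.+1 z%:~R _ (u z) (u (z - 1)) (edge_ratio_gt0 R z).
have [->|z0] := eqVneq z 0; first by rewrite u0 expr0n /= !mul0r !mulr0; lra.
have : 1 <= (z%:~R : R) ^+ 2.
  by rewrite -rmorphXn /= -[1]/(1%:~R) ler_int; nia.
move=> /(vertex_weight_ge k) => vertex.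
have := ler_wpM2r (sqr_ge0 (u z)) vertex.
by lra.
Qed.

(** * The extremal profile *)

(** Bernoulli's inequality (1 - 1/(n+1))^m >= 1 - m/(n+1), cleared of
    denominators. *)
Lemma bernoulli (R : realFieldType) (m n : nat) :
  (n%:R - m%:R + 1) * n.+1%:R ^+ m <= n.+1%:R * n%:R ^+ m :> R.
Proof.
elim: m => [|m IH]; first by rewrite !expr0 !mulr1 subr0 natr1.
rewrite !exprS -[m.+1%:R]natr1.
have n0 : 0 <= n%:R :> R by [].
have m0 : 0 <= m%:R :> R by [].
have := ler_wpM2l n0 IH.
have : 0 <= m%:R * n.+1%:R ^+ m :> R by rewrite mulr_ge0 ?exprn_ge0.
by rewrite -[n.+1%:R]natr1; nra.
Qed.

(** This is n^(-(k + 1/2)), the profile for the exponent k + 1 in the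
    theorem. *)
Definition profile (R : realType) (k n : nat) : R :=
  (n%:R ^+ k * Num.sqrt n%:R)^-1.

Lemma profile_ge0 (R : realType) (k n : nat) : 0 <= profile R k n.
Proof. by rewrite invr_ge0 mulr_ge0 ?exprn_ge0 ?sqrtr_ge0. Qed.

Lemma sqr_profile (R : realType) (k n : nat) :
  profile R k n ^+ 2 = (n%:R ^+ (2 * k).+1)^-1.
Proof.
by rewrite /profile exprVn exprMn sqr_sqrtr // -exprM mulnC exprSr.
Qed.

Lemma profile_anti (R : realType) (k n m : nat) :
  (0 < n)%N -> (n <= m)%N -> profile R k m <= profile R k n.
Proof.
move=> n0 nm; have m0 := leq_trans n0 nm.
rewrite lef_pV2 ?posrE ?mulr_gt0 ?exprn_gt0 ?sqrtr_gt0 ?ltr0n //.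
apply: ler_pM; rewrite ?exprn_ge0 ?sqrtr_ge0 //.
  by rewrite lerXn2r ?nnegrE // ler_nat.
by rewrite ler_sqrt ?ler0n // ler_nat.
Qed.

Lemma profile_le1 (R : realType) (k n : nat) : (0 < n)%N -> profile R k n <= 1.
Proof.
move=> n0; apply: le_trans (@profile_anti R k 1 n _ n0) _ => //.
by rewrite /profile expr1n sqrtr1 mulr1 invr1.
Qed.

(** The discrete counterpart of - f' = (k + 1/2) f / n for f = n^(-(k + 1/2)).
    Factoring the difference of the squares, which are integer powers, reduces
    it to Bernoulli's inequality. *)
Lemma profile_drop (R : realType) (k n : nat) : (2 * k < n)%N ->
  (profile R k n - profile R k n.+1) * (n%:R - (2 * k)%:R) <=
  (2 * k).+1%:R / 2 * profile R k n.+1.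
Proof.
move=> kn; have n0 : (0 < n)%N by exact: leq_ltn_trans kn.
set a := profile R k n; set b := profile R k n.+1.
have b0 : 0 < b by rewrite invr_gt0 mulr_gt0 ?exprn_gt0 ?sqrtr_gt0 ?ltr0n.
have ab : b <= a by exact: profile_anti.
set m := (2 * k).+1.
have an : a ^+ 2 * n%:R ^+ m = 1.
  by rewrite sqr_profile mulVf // expf_neq0 // pnatr_eq0 -lt0n.
have bn : b ^+ 2 * n.+1%:R ^+ m = 1.
  by rewrite sqr_profile mulVf // expf_neq0 // pnatr_eq0.
have kn' : (2 * k)%:R < n%:R :> R by rewrite ltr_nat.
have d0 : 0 < n%:R - (2 * k)%:R :> R by lra.
have key : a ^+ 2 * (n%:R - (2 * k)%:R) <= n.+1%:R * b ^+ 2.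
  have np : 0 < n.+1%:R ^+ m :> R by rewrite exprn_gt0.
  rewrite -(ler_pM2r np) -[X in _ <= X]mulrA bn mulr1.
  have := ler_wpM2l (sqr_ge0 a) (@bernoulli R m n).
  rewrite [X in _ <= X]mulrCA an mulr1 => h; apply: le_trans h.
  rewrite -mulrA -[m%:R]natr1 ler_wpM2l ?sqr_ge0 // ler_wpM2r ?exprn_ge0 //.
  by lra.
have := key; rewrite -[m%:R]natr1 -[n.+1%:R]natr1 -(ler_pM2r b0) => h.
have h2 : 0 <= (a - b) ^+ 2 * (n%:R - (2 * k)%:R).
  by rewrite mulr_ge0 ?sqr_ge0 // ltW.
nra.
Qed.

Lemma profile_energy (R : realType) (k n : nat) : (2 * k < n)%N ->
  (profile R k n.+1 - profile R k n) ^+ 2 * n.+1%:R ^+ (2 * k.+1)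
    * (n%:R - (2 * k)%:R) ^+ 2 <= (2 * k).+1%:R ^+ 2 / 4 * n.+1%:R.
Proof.
move=> kn; have drop := @profile_drop R k n kn.
have anti : profile R k n.+1 <= profile R k n.
  by apply: profile_anti => //; exact: leq_ltn_trans kn.
have kn' : (2 * k)%:R < n%:R :> R by rewrite ltr_nat.
have s1 : n.+1%:R ^+ (2 * k).+1 != 0 :> R by rewrite expf_neq0 // pnatr_eq0.
have -> : (2 * k).+1%:R ^+ 2 / 4 * n.+1%:R =
    ((2 * k).+1%:R / 2 * profile R k n.+1) ^+ 2 * n.+1%:R ^+ (2 * k.+1).
  rewrite exprMn sqr_profile (_ : 2 * k.+1 = (2 * k).+1.+1)%N; last by lia.
  by rewrite [n.+1%:R ^+ _.+2]exprSr; field.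
rewrite mulrAC ler_wpM2r ?exprn_ge0 // -exprMn -sqrrN -mulNr opprB.
rewrite lerXn2r ?nnegrE //; apply: mulr_ge0;
  rewrite ?profile_ge0 ?divr_ge0 //; lra.
Qed.

Lemma eventually_ratio_le (R : realType) (c c' : R) (k : nat) :
  0 <= c -> c < c' -> exists n0, forall n, (n0 <= n)%N ->
  (2 * k < n)%N /\ c * n.+1%:R ^+ 2 <= c' * (n%:R - (2 * k)%:R) ^+ 2.
Proof.
move=> c0 cc'; set m : R := (2 * k).+1%:R.
have m0 : 0 < m by rewrite ltr0n.
have g0 : 0 < c' - c by lra.
have B0 : 0 <= 2 * m * c' / (c' - c).
  by rewrite divr_ge0 ?mulr_ge0 //; lra.
exists (Num.bound (2 * m * c' / (c' - c)) + (2 * k).+1)%N => n n0n.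
split; first by lia.
have : 2 * m * c' / (c' - c) < n.+1%:R.
  apply: lt_le_trans (archi_boundP B0) _; rewrite ler_nat; lia.
rewrite ltr_pdivrMr // => big.
have -> : n%:R - (2 * k)%:R = n.+1%:R - m :> R.
  by rewrite /m -[n.+1%:R]natr1 -[(2 * k).+1%:R]natr1; lra.
have s0 : 0 <= n.+1%:R :> R by [].
have := ler_wpM2r s0 (ltW big).
have : 0 <= c' * m ^+ 2 by rewrite mulr_ge0 ?sqr_ge0 //; lra.
lra.
Qed.

(** * Sharpness *)

Lemma harmonic_sum_unbounded (R : realType) (A : R) (n0 : nat) :
  exists2 N, (n0 <= N)%N & A < \sum_(0 <= i < N) (i.+1%:R)^-1.
Proof.
apply: contrapT => /forall2NP bounded; apply: (@dvg_harmonic R).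
have mono : nondecreasing_seq (series (@harmonic R)).
  by apply: nondecreasing_series => i _ _; exact: harmonic_ge0.
apply: nondecreasing_is_cvgn => //; exists A => _ [N _ <-].
apply: le_trans (mono N (N + n0)%N _) _; first exact: leq_addr.
by case: (bounded (N + n0)%N); rewrite ?leq_addl // => /negP; rewrite -leNgt.
Qed.

Definition truncated_profile (R : realType) (k N : nat) (z : int) : R :=
  if z is Posz n then
    if (0 < n <= N)%N then profile R k n - profile R k N else 0
  else 0.

Arguments truncated_profile : simpl never.

(** The value at N is 0, so N itself is outside the support: the increments
    also vanish beyond N, and energy and norm are sums over the same range. *)
Lemma truncated_profile_supp (R : realType) (k N : nat) (z : int) :
  truncated_profile R k N z != 0 -> exists2 i, (i.+1 < N)%N & z = 1 + i%:Z.
Proof.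
case: z => [n|n]; rewrite /truncated_profile ?eqxx //.
case: ifP => [n1N|_]; last by rewrite eqxx.
have [->|nN _] := eqVneq n N; first by rewrite subrr eqxx.
by exists n.-1; lia.
Qed.

Lemma truncated_profile_finite (R : realType) (k N : nat) :
  finitely_supported (truncated_profile R k N).
Proof.
apply: (@sub_finite_set _ _ [set` [seq 1 + i%:Z | i <- iota 0 N]]).
  move=> z /truncated_profile_supp[i iN ->] /=.
  by apply/mapP; exists i; rewrite // mem_iota /= add0n ltnW.
exact: finite_seq.
Qed.

Lemma truncated_profileS (R : realType) (k N : nat) (i : nat) : (i < N)%N ->
  truncated_profile R k N (1 + i%:Z) = profile R k i.+1 - profile R k N.
Proof. by move=> iN; rewrite /truncated_profile /= iN. Qed.

Lemma truncated_profile_bounds (R : realType) (k N : nat) (z : int) :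
  0 <= truncated_profile R k N z <= 1.
Proof.
case: z => [n|n]; rewrite /truncated_profile ?lexx ?ler01 //.
case: ifP => [/andP[n0 nN]|]; rewrite ?lexx ?ler01 //.
rewrite subr_ge0 profile_anti //= lerBlDr.
by rewrite (le_trans (profile_le1 R k n0)) // lerDl profile_ge0.
Qed.

(** Below the threshold n0 the increments are only known to be at most 1; the
    resulting error does not depend on N. *)
Lemma truncated_profile_energy (R : realType) (k N : nat) (c' : R) (n0 : nat) :
  let u := truncated_profile R k N in
  (forall n, (n0 <= n)%N -> (2 * k < n)%N /\
    (2 * k).+1%:R ^+ 2 / 4 * n.+1%:R ^+ 2 <= c' * (n%:R - (2 * k)%:R) ^+ 2) ->
  (n0 <= N)%N ->
  \sum_(n \in [set: int])
     (`|u n - u (n - 1)| ^+ 2 * (n%:~R - 1 / 2) ^+ (2 * k.+1))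
  <= n0%:R * n0%:R ^+ (2 * k.+1) + c' * \sum_(0 <= i < N) (i.+1%:R)^-1.
Proof.
move=> u hn0 n0N.
have [kn0 cn0] := hn0 _ (leqnn n0).
have c'0 : 0 <= c'.
  have : (2 * k)%:R < n0%:R :> R by rewrite ltr_nat.
  move=> kn; rewrite -(@pmulr_lge0 _ ((n0%:R - (2 * k)%:R) ^+ 2)).
    by apply: le_trans cn0; rewrite mulr_ge0 ?exprn_ge0 // divr_ge0 ?exprn_ge0.
  by rewrite exprn_gt0 // subr_gt0.
rewrite (@fsum_window _ _ 1 N); last first.
  move=> z; have [uz|/truncated_profile_supp[i iN ->] _] := eqVneq (u z) 0; last first.
    by exists i => //; lia.
  have [uz1|/truncated_profile_supp[i iN hz] _] := eqVneq (u (z - 1)) 0.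
    by rewrite uz uz1 subrr normr0 expr0n mul0r eqxx.
  by exists i.+1 => //; lia.
have -> : n0%:R * n0%:R ^+ (2 * k.+1) =
    \sum_(0 <= i < N) (if (i < n0)%N then n0%:R ^+ (2 * k.+1) else 0) :> R.
  rewrite (@big_cat_nat _ _ _ n0) //= addrC big_nat_cond big1 ?add0r; last first.
    by move=> i /andP[/andP[n0i _] _]; rewrite ltnNge n0i.
  rewrite (eq_big_nat _ _ (F2 := fun=> n0%:R ^+ (2 * k.+1))); last first.
    by move=> i /andP[_ ->].
  by rewrite sumr_const_nat subn0 mulr_natl.
rewrite mulr_sumr -big_split /= ler_sum_nat // => i /andP[_ iN].
rewrite real_normK ?num_real // addrAC subrr add0r intrD [1%:~R]/(1 : R).
have -> : 1 + i%:~R - 1 / 2 = i%:R + 1 / 2 :> R by lra.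
have i0 : 0 <= i%:R :> R by [].
have i1 : 0 < i.+1%:R :> R by [].
case: ltnP => [in0|n0i].
  rewrite -[X in X <= _]mul1r -[X in X <= _]addr0 lerD //; last first.
    by rewrite mulr_ge0 // invr_ge0.
  have bounds z : 0 <= u z <= 1 by exact: truncated_profile_bounds.
  have /andP[a0 a1] := bounds (1 + i%:Z).
  have /andP[b0 b1] := bounds i%:Z.
  rewrite mul1r -[X in _ <= X]mul1r ler_pM ?sqr_ge0 //.
  - by rewrite exprn_ge0 //; lra.
  - by nra.
  rewrite lerXn2r ?nnegrE //; first lra.
  have : i.+1%:R <= n0%:R :> R by rewrite ler_nat.
  by rewrite -natr1; lra.
have [ki ci] := hn0 _ n0i.
have i_gt0 : (0 < i)%N by exact: leq_ltn_trans ki.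
rewrite add0r /u truncated_profileS // /truncated_profile i_gt0 (ltnW iN).
rewrite opprB addrA subrK.
have d0 : 0 < (i%:R - (2 * k)%:R) ^+ 2 :> R.
  by rewrite exprn_gt0 // subr_gt0 ltr_nat.
rewrite -(ler_pM2r d0).
have x1 : (i%:R + 1 / 2) ^+ (2 * k.+1) <= i.+1%:R ^+ (2 * k.+1) :> R.
  by rewrite lerXn2r ?nnegrE // -?[i.+1%:R]natr1; lra.
apply: le_trans (ler_wpM2r (ltW d0) (ler_wpM2l (sqr_ge0 _) x1)) _.
apply: le_trans (profile_energy R ki) _.
rewrite [X in _ <= X]mulrAC ler_pdivlMr //; lra.
Qed.

(** Young's inequality (a - b)^2 >= (1 - d) a^2 - b^2 / d separates the profile
    from its value b at N, whose square times the total weight is at most 1. *)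
Lemma truncated_profile_norm (R : realType) (k N : nat) (d : R) :
  let u := truncated_profile R k N in 0 < d -> (0 < N)%N ->
  (1 - d) * \sum_(0 <= i < N) (i.+1%:R)^-1 - d^-1
  <= \sum_(n \in [set: int]) (`|u n| ^+ 2 * n%:~R ^+ (2 * k)).
Proof.
move=> u d0 N0.
rewrite (@fsum_window _ _ 1 N); last first.
  move=> z; have [uz|/truncated_profile_supp[i iN ->] _] := eqVneq (u z) 0.
    by rewrite uz normr0 expr0n mul0r eqxx.
  by exists i => //; exact: ltnW.
have NR : 0 < N%:R :> R by rewrite ltr0n.
have -> : d^-1 = \sum_(0 <= i < N) (d^-1 / N%:R).
  by rewrite sumr_const_nat subn0 -[RHS]mulr_natr divfK // gt_eqF.
rewrite mulr_sumr -sumrB ler_sum_nat // => i /andP[_ iN].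
rewrite real_normK ?num_real // /u truncated_profileS // intrD.
have -> : 1%:~R + i%:~R = i.+1%:R :> R by rewrite addrC natr1.
set a := profile R k i.+1; set b := profile R k N; set w := _ ^+ (2 * k).
have w0 : 0 <= w by rewrite exprn_ge0.
have aw : a ^+ 2 * w = (i.+1%:R)^-1.
  by rewrite sqr_profile exprSr invfM mulrAC mulVf ?mul1r // expf_neq0 ?pnatr_eq0.
have bw : b ^+ 2 * w <= N%:R^-1.
  rewrite sqr_profile exprSr invfM mulrAC ler_piMl ?invr_ge0 //.
  rewrite mulrC ler_pdivrMr ?exprn_gt0 // mul1r.
  by rewrite lerXn2r ?nnegrE // ler_nat.
have young : (1 - d) * a ^+ 2 - d^-1 * b ^+ 2 <= (a - b) ^+ 2.
  have := sqr_ge0 (d * a - b).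
  rewrite -(pmulr_rge0 _ (_ : 0 < d^-1)) ?invr_gt0 //.
  have -> : d^-1 * (d * a - b) ^+ 2 = d * a ^+ 2 - 2 * a * b + d^-1 * b ^+ 2.
    by field; rewrite gt_eqF.
  have := sqr_ge0 b; nra.
have := ler_wpM2r w0 young.
have := ler_wpM2l (_ : 0 <= d^-1) bw; rewrite invr_ge0 ltW // => /(_ isT).
by rewrite -aw; nra.
Qed.

Lemma hardy_sharp (R : realType) (k : nat) (C : R) :
  (2 * k.+1%:R - 1) ^+ 2 / 4 < C ->
  exists u : int -> R,
    [/\ finitely_supported u, u 0 = 0 & ~ hardy_ineq k.+1 C u].
Proof.
have -> : 2 * k.+1%:R - 1 = (2 * k).+1%:R :> R.
  by rewrite -natr1 -[(2 * k).+1%:R]natr1 natrM; lra.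
set c : R := _ / 4 => cC.
have c0 : 0 <= c by rewrite divr_ge0 ?exprn_ge0.
have C0 : 0 < C by lra.
(* With this choice the energy constant c + 2 g stays below the norm constant
   C (1 - d) = C - g = c + 3 g. *)
set g := (C - c) / 4.
have g0 : 0 < g by rewrite divr_gt0 // subr_gt0.
have [|n0 hn0] := @eventually_ratio_le R c (c + 2 * g) k c0; first lra.
pose K : R := n0%:R * n0%:R ^+ (2 * k.+1).
pose d := g / C.
have d0 : 0 < d by rewrite divr_gt0.
have [N n0N big] := @harmonic_sum_unbounded R ((K + C / d) / g) n0.
have N0 : (0 < N)%N by have [] := hn0 _ n0N; lia.
exists (truncated_profile R k N); split.
- exact: truncated_profile_finite.
- by [].
rewrite /hardy_ineq (_ : 2 * k.+1 - 2 = 2 * k)%N; last by lia.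
move=> /(le_trans (ler_wpM2l (ltW C0) (truncated_profile_norm k d0 N0))).
move=> /le_trans /(_ (truncated_profile_energy hn0 n0N)).
rewrite -/K; move: big; set H := \sum_(_ <= _ < _) _.
rewrite ltr_pdivrMr // => big.
rewrite mulrBr mulrA mulrBr mulr1 (_ : C * d = g); last first.
  by rewrite /d mulrC divfK // gt_eqF.
have cg : C = c + 4 * g by rewrite /g; field.
by rewrite {1}cg; lra.
Qed.

Theorem corollary2p2 (R : realType) (k : nat) (hk : (0 < k)%N) :
  (forall u : int -> R, finitely_supported u -> u 0 = 0 ->
     hardy_ineq k ((2 * k%:R - 1) ^+ 2 / 4) u) /\
  (forall C : R, (2 * k%:R - 1) ^+ 2 / 4 < C ->
     exists u : int -> R,
       [/\ finitely_supported u, u 0 = 0 & ~ hardy_ineq k C u]).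
Proof.
case: k hk => // k _; split=> [u|C]; first exact: hardy.
exact: hardy_sharp.
Qed.
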